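(* Let $\gamma$ be a $3$-braid. Then its fractional Dehn twist coefficient $\omega(\gamma)$ is - $\omega(\gamma)=\ell$, if $\gamma$ is conjugate to $\Delta^{2\ell}a^p$ with $\ell\in\mathbb{Z}$, $p\geq 0$; - $\omega(\gamma)=\frac{p+1}{6}+\ell$, if $\gamma$ is conjugate to $\Delta^{2\ell}a^pb$ with $\ell\in\mathbb{Z}$, $p\in\{1,2,3\}$; - $\omega(\gamma)=r+\ell$, if $\gamma$ is conjugate to $\Delta^{2\ell}a^{p_1}b^{q_1}\cdots a^{p_r}b^{q_r}$ with $\ell\in\mathbb{Z}$, $r\geq 1$, $p_i,q_i\geq 2$ for $i\in\{1,\dots,r\}$, or to $\Delta^{2\ell+1}a^{p_1}b^{q_1}\cdots a^{p_{r-1}}b^{q_{r-1}}a^{p_r}$ with $\ell\in\mathbb{Z}$, $r\geq 1$, $p_r\geq 2$, $p_i,q_i\geq 2$ for $i\in\{1,\dots,r-1\}$.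
   Context: $B_3=\langle a,b\mid aba=bab\rangle$ is the braid group on three strands, with $a=\sigma_1$, $b=\sigma_2$ the standard Artin generators (positive crossings) and $\Delta=aba=bab$. Every $3$-braid is conjugate to one of the listed braids. The fractional Dehn twist coefficient $\omega\colon B_n\to\mathbb{R}$ is the homogeneous quasimorphism (constant on conjugacy classes) measuring the twisting of a braid, viewed as a mapping class of the $n$-punctured closed disk, near the boundary, normalized so that the positive full twist $\Delta^2$ has $\omega(\Delta^2)=1$. Following Malyutin it can be defined as follows. Let $<$ be the Dehornoy order on $B_n$: the left-invariant total order in which $\beta>1$ if and only if $\beta$ is represented by a word which, for some $i$, contains $\sigma_i$ but not $\sigma_i^{-1}$ and contains no $\sigma_j^{\pm1}$ with $j<i$. For $\beta\in B_n$ let $\lfloor\beta\rfloor$ be the unique integer $m$ with $\Delta^{2m}\leq\beta<\Delta^{2m+2}$. Then $\omega(\beta)=\lim_{k\to\infty}\lfloor\beta^k\rfloor/k$. *)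

(* Defs.v *)
From HB Require Import structures.
From mathcomp Require Import all_boot all_order all_algebra.
From mathcomp Require Import all_classical all_reals all_analysis.

Set Implicit Arguments.
Unset Strict Implicit.
Unset Printing Implicit Defensive.

Import Order.TTheory GRing.Theory Num.Theory.
Import numFieldNormedType.Exports.

Local Open Scope quotient_scope.
Local Open Scope classical_set_scope.
Local Open Scope group_scope.

(* The letter (i, true) stands for the Artin generator sigma_(i+1) and
   (i, false) for its inverse: 'I_n.-1 starts at 0. *)
Definition letter (n : nat) : Type := ('I_n.-1 * bool)%type.
Definition word (n : nat) : Type := seq (letter n).

Definition flip (n : nat) (x : letter n) : letter n := (x.1, ~~ x.2).
Definition word_inv (n : nat) (w : word n) : word n := rev (map (@flip n) w).

(* The congruence on braid words generated by free cancellation and the Artin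
   relations. *)
Inductive braid_eq (n : nat) : word n -> word n -> Prop :=
| braid_eq_refl u : braid_eq u u
| braid_eq_sym u v : braid_eq u v -> braid_eq v u
| braid_eq_trans u v w : braid_eq u v -> braid_eq v w -> braid_eq u w
| braid_eq_cat u u' v v' :
    braid_eq u u' -> braid_eq v v' -> braid_eq (u ++ v) (u' ++ v')
| braid_eq_cancel x : braid_eq [:: x; flip x] [::]
| braid_eq_far (i j : 'I_n.-1) : (i.+1 < j)%N ->
    braid_eq [:: (i, true); (j, true)] [:: (j, true); (i, true)]
| braid_eq_near (i j : 'I_n.-1) : j = i.+1 :> nat ->
    braid_eq [:: (i, true); (j, true); (i, true)]
             [:: (j, true); (i, true); (j, true)].

Section BraidGroup.
Variable n : nat.
Implicit Types u v w : word n.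

Definition braid_eqb : rel (word n) := fun u v => `[< braid_eq u v >].

Fact braid_eqb_refl : reflexive braid_eqb.
Proof. by move=> u; apply/asboolP; exact: braid_eq_refl. Qed.

Fact braid_eqb_sym : symmetric braid_eqb.
Proof. by move=> u v; apply/asboolP/asboolP; exact: braid_eq_sym. Qed.

Fact braid_eqb_trans : transitive braid_eqb.
Proof.
move=> v u w /asboolP uv /asboolP vw; apply/asboolP.
exact: braid_eq_trans uv vw.
Qed.

Canonical braid_equiv :=
  EquivRel braid_eqb braid_eqb_refl braid_eqb_sym braid_eqb_trans.

Definition braid : Type := {eq_quot braid_equiv}.
HB.instance Definition _ := Choice.on braid.
HB.instance Definition _ := EqQuotient.on braid.

Definition braid_of_word (w : word n) : braid := \pi w.

Lemma braid_of_wordP u v :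
  braid_of_word u = braid_of_word v <-> braid_eq u v.
Proof. by split=> [/eqmodP/asboolP|uv]; last exact/eqmodP/asboolP. Qed.

Lemma braid_of_word_surj (x : braid) : exists w, x = braid_of_word w.
Proof. by exists (repr x); rewrite /braid_of_word reprK. Qed.

Lemma flipK : involutive (@flip n).
Proof. by case=> i b; rewrite /flip /= negbK. Qed.

Lemma word_inv_cat u v : word_inv (u ++ v) = word_inv v ++ word_inv u.
Proof. by rewrite /word_inv map_cat rev_cat. Qed.

Lemma word_invK : involutive (@word_inv n).
Proof. by move=> w; rewrite /word_inv map_rev revK mapK//; exact: flipK. Qed.

Lemma braid_eq_mulrV w : braid_eq (w ++ word_inv w) [::].
Proof.
elim: w => [|x w IHw]; first exact: braid_eq_refl.
rewrite -cat1s word_inv_cat -catA (catA w).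
apply: (@braid_eq_trans _ _ ([:: x] ++ ([::] ++ word_inv [:: x]))).
  apply: braid_eq_cat; first exact: braid_eq_refl.
  by apply: braid_eq_cat => //; exact: braid_eq_refl.
exact: braid_eq_cancel.
Qed.

Lemma braid_eq_mulVr w : braid_eq (word_inv w ++ w) [::].
Proof. by have := braid_eq_mulrV (word_inv w); rewrite word_invK. Qed.

Lemma braid_eq_inv u v : braid_eq u v -> braid_eq (word_inv u) (word_inv v).
Proof.
move=> uv; have r w := @braid_eq_refl n w.
apply: (@braid_eq_trans _ _ (word_inv u ++ (v ++ word_inv v))).
  rewrite -[X in braid_eq X _]cats0; apply: braid_eq_cat => //.
  by apply: braid_eq_sym; exact: braid_eq_mulrV.
rewrite catA -[X in braid_eq _ X]cat0s; apply: braid_eq_cat => //.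
apply: (@braid_eq_trans _ _ (word_inv u ++ u)); last exact: braid_eq_mulVr.
by apply: braid_eq_cat => //; exact: braid_eq_sym.
Qed.

Definition braid_mul (x y : braid) : braid :=
  braid_of_word (repr x ++ repr y).
Definition braid_inv (x : braid) : braid := braid_of_word (word_inv (repr x)).

Lemma braid_eq_repr w : braid_eq (repr (braid_of_word w)) w.
Proof. by apply/braid_of_wordP; rewrite /braid_of_word reprK. Qed.

Lemma braid_mulE u v :
  braid_mul (braid_of_word u) (braid_of_word v) = braid_of_word (u ++ v).
Proof. by apply/braid_of_wordP/braid_eq_cat; exact: braid_eq_repr. Qed.

Lemma braid_invE u : braid_inv (braid_of_word u) = braid_of_word (word_inv u).
Proof. by apply/braid_of_wordP/braid_eq_inv; exact: braid_eq_repr. Qed.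

Fact braid_mulA : associative braid_mul.
Proof.
move=> x y z.
have [u ->] := braid_of_word_surj x; have [v ->] := braid_of_word_surj y.
by have [w ->] := braid_of_word_surj z; rewrite !braid_mulE catA.
Qed.

Fact braid_mul1 : left_id (braid_of_word [::]) braid_mul.
Proof. by move=> x; have [u ->] := braid_of_word_surj x; rewrite braid_mulE. Qed.

Fact braid_mulr1 : right_id (braid_of_word [::]) braid_mul.
Proof.
by move=> x; have [u ->] := braid_of_word_surj x; rewrite braid_mulE cats0.
Qed.

Fact braid_mulV : left_inverse (braid_of_word [::]) braid_inv braid_mul.
Proof.
move=> x; have [u ->] := braid_of_word_surj x; rewrite braid_invE braid_mulE.
exact/braid_of_wordP/braid_eq_mulVr.
Qed.

Fact braid_mulrV : right_inverse (braid_of_word [::]) braid_inv braid_mul.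
Proof.
move=> x; have [u ->] := braid_of_word_surj x; rewrite braid_invE braid_mulE.
exact/braid_of_wordP/braid_eq_mulrV.
Qed.

HB.instance Definition _ := isGroup.Build braid
  braid_mulA braid_mul1 braid_mulr1 braid_mulV braid_mulrV.

Lemma braid_of_word_cat u v :
  braid_of_word (u ++ v) = braid_of_word u * braid_of_word v.
Proof. by rewrite -braid_mulE. Qed.

Definition sigma (i : 'I_n.-1) : braid := braid_of_word [:: (i, true)].

(* Garside's half twist
   (sigma_1 ... sigma_(n-1)) (sigma_1 ... sigma_(n-2)) ... sigma_1. *)
Definition Delta : braid :=
  \prod_(k < n.-1) \prod_(i < n.-1 | (i + k < n.-1)%N) sigma i.

End BraidGroup.

Definition expgz (G : groupType) (x : G) (m : int) : G :=
  match m with Posz k => x ^+ k | Negz k => x ^- k.+1 end.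

Definition conjugate (G : groupType) (x y : G) : Prop :=
  exists g : G, x = y ^ g.

Section FractionalDehnTwist.
Variable n : nat.
Implicit Types (x y : braid n) (m : int).

Definition sigma_positive (w : word n) : Prop :=
  exists i : 'I_n.-1, [/\ (i, true) \in w, (i, false) \notin w &
    forall (j : 'I_n.-1) (e : bool), (j < i)%N -> (j, e) \notin w].

Definition dehornoy_pos x : Prop :=
  exists w : word n, braid_of_word w = x /\ sigma_positive w.

Definition dehornoy_lt x y : Prop := dehornoy_pos (x^-1 * y).

Definition dehornoy_le x y : Prop := x = y \/ dehornoy_lt x y.

Definition is_floor x m : Prop :=
  dehornoy_le (expgz (Delta n) (2 * m)%R) x /\
  dehornoy_lt x (expgz (Delta n) (2 * m + 2)%R).

Definition dehornoy_floor x : int := xget 0%R [set m | is_floor x m].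

Variable R : realType.

Definition floor_ratio x : nat -> R :=
  fun k => ((dehornoy_floor (x ^+ k)%g)%:~R / k%:R)%R.

Definition fdtc x : R := limn (floor_ratio x).

(* fdtc x has value c, and is not a default value: every floor entering its
   definition exists and is unique, and the limit exists (cf. is_derive). *)
Definition is_fdtc x (c : R) : Prop :=
  [/\ forall k : nat, exists! m, is_floor (x ^+ k) m,
      cvgn (floor_ratio x) & fdtc x = c].

End FractionalDehnTwist.

Definition sigma1 : braid 3 := @sigma 3 ord0.
Definition sigma2 : braid 3 := @sigma 3 ord_max.

Lemma Delta3E : Delta 3 = sigma1 * sigma2 * sigma1.
Proof.
rewrite /Delta /= !big_ord_recl !big_ord0 /=.
rewrite (big_mkcond (fun i : 'I_2 => i + 0 < 2)%N).
rewrite (big_mkcond (fun i : 'I_2 => i + bump 0 0 < 2)%N).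
rewrite !big_ord_recl !big_ord0 /= !mulg1 /sigma1 /sigma2.
by congr (_ * sigma _ * _); apply: val_inj.
Qed.

Lemma braid3_rel : sigma1 * sigma2 * sigma1 = sigma2 * sigma1 * sigma2.
Proof.
rewrite /sigma1 /sigma2 /sigma -!(braid_of_word_cat [:: _] [:: _]).
rewrite -!(braid_of_word_cat ([:: _] ++ [:: _]) [:: _]); apply/braid_of_wordP.
exact: (@braid_eq_near 3 ord0 ord_max erefl).
Qed.

(* Main.v *)
Require Import Defs.
From mathcomp Require Import all_boot all_order all_algebra.
From mathcomp Require Import all_classical all_reals all_analysis.
From mathcomp Require Import ring lra zify.

(** The Dehornoy floor is a quasimorphism of defect 1, so the twist
    coefficient of [x] is the slope of [k |-> floor (x ^+ k)], and it can be
    read off from any description of the powers of [x] up to bounded error.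

    Write [a] and [b] for the generators.  Such a description comes from
    alternating braids, the words in [a] and [b^-1] only, or in [a^-1] and [b]
    only.  Conjugation by [Delta] exchanges the two kinds.  From
    [a * b = Delta * a^-1] and [b * a = Delta * b^-1], every 3-braid is a power
    of [Delta] times an alternating braid ([twist_alternating]).  Multiplying an
    alternating braid by [Delta] or [Delta^-1] settles its sign
    ([alternating_halftwist]), so its floor is 0 or -1.  Since the powers of an
    alternating braid are again alternating, the coefficient of [Delta^2m * u]
    with [u] alternating is [m] ([twist_rate_twist],
    [twist_rate_alternating]).

    The braids of the first and third families are of this form up to
    conjugacy: each block [a^p b^q] with [p, q >= 2] is conjugate by [b] to
    [Delta^2 a^-1 b^(p-2) a^-1 b^(q-2)], and likewise [a^p Delta] is conjugate
    to [Delta^2 a^-1 b^(p-2)]; each block therefore contributes one full twist.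
    The braids [a^p b] with [p = 1, 2, 3] have a power which is a full twist or
    its square.

    What remains is that the floor is well defined.  Existence follows from
    the normal form above.  Uniqueness says that a sigma-positive word is never
    trivial.  For this, the 3-strand braid group acts on the line by
    increasing bijections, [Delta] acting as the translation by 1/2, in such a
    way that a sigma-positive word moves some point to the right
    ([sigma_positive_act]). *)

Set Implicit Arguments.
Unset Strict Implicit.
Unset Printing Implicit Defensive.

Import Order.TTheory GRing.Theory Num.Theory.
Import numFieldNormedType.Exports.

Local Open Scope ring_scope.

(** * An action of the 3-strand braid group on the line *)

Section Line.
Variable F : archiRealFieldType.
Implicit Types s t : F.

(** PSL(2, Z) acts on the rational projective line; in the coordinate of
    Minkowski's question mark function the translation [z |-> z + 1] becomes
    piecewise affine on the circle, and this is its branch on [0, 1). *)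
Definition shear_unit (s : F) : F :=
  if s < 1 / 4 then 2 * s else if s < 1 / 2 then s + 1 / 4 else s / 2 + 1 / 2.

(** The lift of [shear_unit] to the universal cover which fixes the
    integers. *)
Definition shear (t : F) : F :=
  (Num.floor t)%:~R + shear_unit (t - (Num.floor t)%:~R).

Lemma shearDz t (n : int) : shear (t + n%:~R) = shear t + n%:~R.
Proof.
rewrite /shear floorDrz ?intr_int// intrKfloor rmorphD /=.
by rewrite (_ : t + _ - _ = t - (Num.floor t)%:~R); ring.
Qed.

Lemma shearD1 t : shear (t + 1) = shear t + 1.
Proof. exact: (shearDz t 1). Qed.

Lemma shear01 t : 0 <= t < 1 -> shear t = shear_unit t.
Proof.
move=> t01; rewrite /shear (_ : Num.floor t = 0) ?subr0 ?add0r//.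
exact: floor_def.
Qed.

Lemma floor_decomp (t : F) :
  exists (n : int) (s : F), t = s + n%:~R /\ 0 <= s < 1.
Proof.
exists (Num.floor t), (t - (Num.floor t)%:~R); split; first by ring.
by have := floor_itv t; rewrite rmorphD /=; lra.
Qed.

(** The affine pieces are given on closed intervals: the pieces agree at the
    break points, and so does the next period at 1. *)
Lemma shear_fst t : 0 <= t <= 1 / 4 -> shear t = 2 * t.
Proof.
move=> ?; rewrite shear01 /shear_unit; last lra.
by case: ltP => ?; [|case: ltP => ?]; lra.
Qed.

Lemma shear_snd t : 1 / 4 <= t <= 1 / 2 -> shear t = t + 1 / 4.
Proof.
move=> ?; rewrite shear01 /shear_unit; last lra.
by case: ltP => ?; [|case: ltP => ?]; lra.
Qed.

Lemma shear_trd t : 1 / 2 <= t <= 1 -> shear t = t / 2 + 1 / 2.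
Proof.
move=> ?; have [t1|t1] := ltP t 1.
  rewrite shear01 /shear_unit; last lra.
  by case: ltP => ?; [|case: ltP => ?]; lra.
have -> : t = 0 + 1 by lra.
by rewrite shearD1 shear_fst; lra.
Qed.

Lemma shear_ge t : t <= shear t.
Proof.
have [n [s [-> s01]]] := floor_decomp t; rewrite shearDz lerD2r.
by rewrite shear01// /shear_unit; case: ltP => ?; [|case: ltP => ?]; lra.
Qed.

Lemma shear_lt s t : s < t -> shear s < shear t.
Proof.
have [n [s' [-> s01]]] := floor_decomp s.
rewrite -ltrBrDr -[in shear t](subrK n%:~R t) !shearDz ltrD2r.
move: (t - n%:~R) => {}t st; have [t1|t1] := ltP t 1; last first.
  apply: lt_le_trans (le_trans t1 (shear_ge t)); rewrite shear01//.
  rewrite /shear_unit.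
  by case: (ltP s' (1 / 4)) => ?; case: (ltP s' (1 / 2)) => ?; lra.
rewrite !shear01 ?/shear_unit; try lra.
case: (ltP s' (1 / 4)) => ?; case: (ltP t (1 / 4)) => ?;
by case: (ltP s' (1 / 2)) => ?; case: (ltP t (1 / 2)) => ?; lra.
Qed.

(** Both generators act by [shear], conjugated by half-integer translations.
    Letting [i] be any natural number makes this 2-periodic in [i] (see
    [sigma_actSS]), so the two forms of the braid relation become one. *)
Definition sigma_act (i : nat) (t : F) : F := shear (t + i%:R / 2) - i%:R / 2.

Lemma sigma_act_half i t : sigma_act i (t + 1 / 2) = sigma_act i.+1 t + 1 / 2.
Proof.
rewrite /sigma_act -[in i.+1%:R]natr1.
rewrite [t + _ + _](_ : _ = t + (i%:R + 1) / 2); last by field.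
by field.
Qed.

Lemma sigma_actSS i t : sigma_act i.+2 t = sigma_act i t.
Proof.
rewrite /sigma_act -[in i.+2%:R]natr1 -natr1.
by rewrite [t + _](_ : _ = t + i%:R / 2 + 1) ?shearD1; field.
Qed.

(** The common value of [aba] and [bab] is the action of the half twist. *)
Lemma sigma_act_braid i t :
  sigma_act i (sigma_act i.+1 (sigma_act i t)) = t + 1 / 2.
Proof.
suff shear_braid s : shear (shear (shear s + 1 / 2) - 1 / 2) = s + 1 / 2.
  rewrite /sigma_act -[in i.+1%:R]natr1; move: (shear_braid (t + i%:R / 2)).
  move: (shear (t + _)) => y.
  rewrite [y - _ + _](_ : _ = y + 1 / 2); last by field.
  move: (shear (y + _)) => z.
  rewrite [z - _ + _](_ : _ = z - 1 / 2); last by field.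
  by move=> ->; field.
have [n [{}s [-> s01]]] := floor_decomp s.
suff eqs : shear (shear (shear s + 1 / 2) - 1 / 2) = s + 1 / 2.
  by rewrite !(shearDz, addrAC _ n%:~R) eqs.
have [s1|s1] := leP s (1 / 4).
  have -> : shear s = 2 * s by apply: shear_fst; lra.
  have -> : shear (2 * s + 1 / 2) = s + 3 / 4 by rewrite shear_trd; lra.
  by rewrite shear_snd; lra.
have [s2|s2] := leP s (1 / 2).
  have -> : shear s = s + 1 / 4 by apply: shear_snd; lra.
  have -> : s + 1 / 4 + 1 / 2 = s - 1 / 4 + 1 by lra.
  have -> : shear (s - 1 / 4 + 1) = 2 * s + 1 / 2.
    by rewrite shearD1 shear_fst; lra.
  by rewrite shear_trd; lra.
have -> : shear s = s / 2 + 1 / 2 by apply: shear_trd; lra.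
have -> : s / 2 + 1 / 2 + 1 / 2 = s / 2 + 1 by lra.
have -> : shear (s / 2 + 1) = s / 2 + 5 / 4.
  by rewrite shearD1 shear_snd; lra.
have -> : s / 2 + 5 / 4 - 1 / 2 = s / 2 - 1 / 4 + 1 by lra.
by rewrite shearD1 shear_fst; lra.
Qed.

Lemma sigma_act_ge i t : t <= sigma_act i t.
Proof. by rewrite /sigma_act; have := shear_ge (t + i%:R / 2); lra. Qed.

Lemma sigma_act_lt i s t : s < t -> sigma_act i s < sigma_act i t.
Proof. by move=> st; rewrite ltrD2r; apply: shear_lt; rewrite ltrD2r. Qed.

(** Solving [sigma_act_braid] for the inverse of [sigma_act i] exhibits it as a
    composition of increasing maps. *)
Definition sigma_actV (i : nat) (t : F) : F :=
  sigma_act i.+1 (sigma_act i (t - 1 / 2)).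

Lemma sigma_actVK i : cancel (sigma_actV i) (sigma_act i).
Proof. by move=> t; rewrite /sigma_actV sigma_act_braid subrK. Qed.

Lemma sigma_actK i : cancel (sigma_act i) (sigma_actV i).
Proof.
move=> t; rewrite /sigma_actV.
have halfN k y : sigma_act k (y - 1 / 2) = sigma_act k.+1 y - 1 / 2.
  by rewrite -[in RHS](subrK (1 / 2) y) sigma_act_half sigma_actSS addrK.
by rewrite !halfN sigma_actSS sigma_act_braid addrK.
Qed.

Definition letter_act (n : nat) (x : letter n) : F -> F :=
  if x.2 then sigma_act x.1 else sigma_actV x.1.

Definition word_act (n : nat) (w : word n) (t : F) : F :=
  foldr (fun x : letter n => letter_act x) t w.

Lemma letter_act_lt n (x : letter n) s t :
  s < t -> letter_act x s < letter_act x t.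
Proof.
rewrite /letter_act; case: x.2 => st; first exact: sigma_act_lt.
by do 2!apply: sigma_act_lt; rewrite ltrD2r.
Qed.

Lemma word_act_cat n (u v : word n) t :
  word_act (u ++ v) t = word_act u (word_act v t).
Proof. by rewrite /word_act foldr_cat. Qed.

Lemma word_act_eq (u v : word 3) : braid_eq u v -> word_act u =1 word_act v.
Proof.
elim=> {u v} //=.
- by move=> u v _ IH t; rewrite IH.
- by move=> u v w _ IHu _ IHv t; rewrite IHu IHv.
- by move=> u u' v v' _ IHu _ IHv t; rewrite !word_act_cat IHu IHv.
- by move=> [i []] t /=; rewrite /letter_act /= ?sigma_actK ?sigma_actVK.
- by move=> [[|[|//]] ?] [[|[|//]] ?].
move=> i j ij t; rewrite /= /letter_act /= ij sigma_act_braid.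
by rewrite -(sigma_actSS i) sigma_act_braid.
Qed.

(** The point [(1 - i) / 2] is fixed by the generators of index greater than
    [i] and moved to the right by the generator of index [i]; a word with no
    other letters can never bring it back. *)
Lemma sigma_positive_act (w : word 3) :
  sigma_positive w -> exists t : F, t < word_act w t.
Proof.
case=> i [iw Niw minw]; exists ((1 - i%:R) / 2).
set p := _ / 2.
have fix_p (j : 'I_2) : (i < j)%N -> sigma_act j p = p.
  move=> ij; have -> : j = i.+1 :> nat.
    by case: i j ij {iw Niw minw p} => [[|[|//]]?] [[|[|//]]?].
  rewrite /sigma_act /p -[in i.+1%:R]natr1.
  rewrite [_ / 2 + _](_ : _ = 0 + 1); last by field.
  by rewrite shearD1 shear_fst; last lra; field.
have mv_p : p < sigma_act i p.
  rewrite /sigma_act [p + _](_ : _ = 1 / 2); last by rewrite /p; field.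
  by rewrite shear_trd; last lra; rewrite /p; lra.
have fixV_p (j : 'I_2) : (i < j)%N -> sigma_actV j p = p.
  by move=> /fix_p {1}<-; rewrite sigma_actK.
suff [pw] : p <= word_act w p /\ ((i, true) \in w -> p < word_act w p) by apply.
elim: w {iw} Niw minw => [|[j e] w IHw]; first by split.
rewrite inE negb_or => /andP[Ne Nw] minw.
have [|pw ltpw] := IHw Nw.
  by move=> k f ki; have := minw k f ki; rewrite inE negb_or => /andP[].
have Nji : ~~ (j < i)%N.
  by apply/negP => ji; have := minw j e ji; rewrite inE eqxx.
have fix_le x q r : letter_act x p = q -> p <= r -> @letter_act 3 x r >= q.
  move=> <-; rewrite !le_eqVlt => /orP[/eqP->|/(letter_act_lt x)->].
    by rewrite eqxx.
  by rewrite orbT.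
rewrite /=; have [ij|ij] := ltnP i j.
  have fx : letter_act ((j, e) : letter 3) p = p.
    by rewrite /letter_act /=; case: (e); rewrite ?fix_p ?fixV_p.
  split; first exact: fix_le fx pw.
  rewrite inE => /predU1P[[eji]|/ltpw]; first by rewrite eji ltnn in ij.
  by move/(letter_act_lt (j, e)); rewrite fx.
have eji : j = i by apply/val_inj/eqP; rewrite eqn_leq ij leqNgt Nji.
move: Ne; rewrite eji xpair_eqE eqxx /= => /negbTE; case: e {IHw minw} => //= _.
have lt : p < sigma_act i (word_act w p).
  exact: lt_le_trans mv_p (fix_le (i, true) _ _ erefl pw).
by split => //; exact: ltW.
Qed.

End Line.

Lemma dehornoy_pos1 : ~ dehornoy_pos (1%g : braid 3).
Proof.
case=> w [/braid_of_wordP w1 /(sigma_positive_act rat)[t]].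
by rewrite (word_act_eq w1) ltxx.
Qed.

Local Close Scope ring_scope.
Local Open Scope group_scope.

(** * The Dehornoy order *)

Lemma sigma_positive_cat n (u v : word n) :
  sigma_positive u -> sigma_positive v -> sigma_positive (u ++ v).
Proof.
case=> i [iu Niu minu] [j [jv Njv minv]].
have [ij|ji|/val_inj eij] := ltngtP i j.
- exists i; split; first by rewrite mem_cat iu.
    by rewrite mem_cat negb_or Niu minv.
  by move=> k e ki; rewrite mem_cat negb_or minu// minv// (ltn_trans ki).
- exists j; split; first by rewrite mem_cat jv orbT.
    by rewrite mem_cat negb_or Njv minu.
  by move=> k e kj; rewrite mem_cat negb_or minv// minu// (ltn_trans kj).
exists i; split; first by rewrite mem_cat iu.
  by rewrite mem_cat negb_or Niu eij Njv.
by move=> k e ki; rewrite mem_cat negb_or minu// minv// -eij.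
Qed.

Lemma dehornoy_pos_mul n (x y : braid n) :
  dehornoy_pos x -> dehornoy_pos y -> dehornoy_pos (x * y).
Proof.
move=> [u [<- pu]] [v [<- pv]]; exists (u ++ v).
by rewrite braid_of_word_cat; split=> //; exact: sigma_positive_cat.
Qed.

Lemma dehornoy_lt_trans n (y x z : braid n) :
  dehornoy_lt x y -> dehornoy_lt y z -> dehornoy_lt x z.
Proof.
rewrite /dehornoy_lt => xy yz; have := dehornoy_pos_mul xy yz.
by rewrite -mulgA mulVKg.
Qed.

Lemma dehornoy_le_lt_trans n (y x z : braid n) :
  dehornoy_le x y -> dehornoy_lt y z -> dehornoy_lt x z.
Proof. by case=> [->//|]; exact: dehornoy_lt_trans. Qed.

Lemma dehornoy_lt_le_trans n (y x z : braid n) :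
  dehornoy_lt x y -> dehornoy_le y z -> dehornoy_lt x z.
Proof. by move=> xy [<-//|]; exact: dehornoy_lt_trans. Qed.

Lemma dehornoy_le_trans n (y x z : braid n) :
  dehornoy_le x y -> dehornoy_le y z -> dehornoy_le x z.
Proof.
by move=> xy [<-//|yz]; right; exact: dehornoy_le_lt_trans yz.
Qed.

Lemma dehornoy_lt_mul2l n (z x y : braid n) :
  dehornoy_lt (z * x) (z * y) <-> dehornoy_lt x y.
Proof. by rewrite /dehornoy_lt invgM -mulgA mulKg. Qed.

Lemma dehornoy_le_mul2l n (z x y : braid n) :
  dehornoy_le x y -> dehornoy_le (z * x) (z * y).
Proof. by case=> [->|?]; [left|right; apply/dehornoy_lt_mul2l]. Qed.

Lemma dehornoy_lt_irr (x : braid 3) : ~ dehornoy_lt x x.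
Proof. by rewrite /dehornoy_lt mulVg => /dehornoy_pos1. Qed.

(** * Integer powers and the half twist *)

Section Expgz.
Variable G : groupType.
Implicit Types (x y : G) (m n : int).

Lemma expgzS x m : expgz x (m + 1)%R = expgz x m * x.
Proof.
case: m => [k|[|k]]; first by rewrite addrC -intS /= expgSr.
  by rewrite /= expg1 mulVg.
have -> : (Negz k.+1 + 1 = Negz k)%R by lia.
by rewrite /= (expgS _ k.+1) invgM mulgVK.
Qed.

Lemma expgzP x m : expgz x (m - 1)%R = expgz x m * x^-1.
Proof. by rewrite -[in RHS](subrK 1%R m) expgzS mulgK. Qed.

Lemma expgzD x m n : expgz x (m + n)%R = expgz x m * expgz x n.
Proof.
elim/int_rect: n => [|n IHn|n IHn]; first by rewrite addr0 mulg1.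
  by rewrite -addn1 PoszD addrA !expgzS IHn mulgA.
by rewrite -addn1 PoszD opprD addrA !expgzP IHn mulgA.
Qed.

Lemma expgzN x m : expgz x (- m)%R = (expgz x m)^-1.
Proof. by apply/eqP; rewrite -mulg_eq1 -expgzD addNr. Qed.

Lemma expgz_commute x y m : commute x y -> commute x (expgz y m).
Proof.
by move=> xy; case: m => k; [|apply: commuteV]; exact: commuteX.
Qed.

End Expgz.

Local Notation a := sigma1 (only parsing).
Local Notation b := sigma2 (only parsing).
Local Notation D := (Delta 3) (only parsing).
Local Notation twist m := (expgz (Delta 3) (2 * m)%R) (only parsing).

Lemma sigma12 : a * b = D * a^-1.
Proof. by rewrite Delta3E mulgK. Qed.
Lemma sigma21 : b * a = D * b^-1.
Proof. by rewrite Delta3E braid3_rel mulgK. Qed.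
Lemma sigma1D : a * D = D * b.
Proof. by rewrite {1}Delta3E braid3_rel Delta3E !mulgA. Qed.
Lemma sigma2D : b * D = D * a.
Proof. by rewrite Delta3E !mulgA -braid3_rel. Qed.

Lemma sigma1J : a ^ D = b.
Proof. by rewrite conjgE sigma1D mulKg. Qed.
Lemma sigma2J : b ^ D = a.
Proof. by rewrite conjgE sigma2D mulKg. Qed.

Definition letter_braid (x : letter 3) : braid 3 := braid_of_word [:: x].

Lemma letter_braid_flip x : letter_braid (flip x) = (letter_braid x)^-1.
Proof. exact: esym (braid_invE [:: x]). Qed.

Definition letter_swap (x : letter 3) : letter 3 := (rev_ord x.1, x.2).

Lemma letter_braidE x :
  letter_braid x =
    let s := if x.1 == ord0 then a else b in if x.2 then s else s^-1.
Proof.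
suff pos i : letter_braid (i, true) = if i == ord0 then a else b.
  by case: x => i [] /=; rewrite -pos // -letter_braid_flip.
case: eqVneq => [->//|nz]; congr (letter_braid (_, _)).
by apply: val_inj; case: i nz => [[|[|//]] ?].
Qed.

Lemma letter_braidJ x : letter_braid x ^ D = letter_braid (letter_swap x).
Proof.
rewrite !letter_braidE; case: x => -[[|[|//]] ?] [] /=;
 by rewrite ?conjVg ?sigma1J ?sigma2J.
Qed.

Lemma braid_of_wordJ w :
  braid_of_word w ^ D = braid_of_word (map letter_swap w).
Proof.
elim: w => [|x w IHw]; first exact: conj1g.
rewrite -cat1s map_cat !braid_of_word_cat conjMg IHw.
by rewrite -/(letter_braid x) letter_braidJ.
Qed.

(** Conjugation by [Delta] exchanges the two generators, so conjugating twice
    is the identity. *)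
Lemma commuteD2 x : commute x (D ^+ 2).
Proof.
suff : x ^ (D ^+ 2) = x by rewrite /commute conjgC => ->.
have [w ->] := braid_of_word_surj x.
rewrite [D ^+ 2]expgS expg1 conjgM (braid_of_wordJ w) braid_of_wordJ.
rewrite -map_comp map_id_in// => -[i e] _.
by rewrite /letter_swap /= rev_ordK.
Qed.

Lemma commute_twist x m : commute x (twist m).
Proof.
suff -> : twist m = expgz (D ^+ 2) m by exact/expgz_commute/commuteD2.
elim/int_rect: m => [//|m IH|m IH].
  by rewrite (intS m) addrC mulrDr [LHS]expgzD IH expgzS.
by rewrite (intS m) opprD addrC mulrDr [LHS]expgzD IH expgzP.
Qed.

Lemma twistD m n : twist (m + n) = twist m * twist n.
Proof. by rewrite mulrDr expgzD. Qed.
Lemma twistN m : twist (- m) = (twist m)^-1.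
Proof. by rewrite mulrN expgzN. Qed.
Lemma twist1 : twist 1 = D * D.
Proof. by rewrite mulr1 /= expgS expg1. Qed.

Lemma conjDD x : (x ^ D) ^ D = x.
Proof.
rewrite -conjgM conjgE; apply: canLR (mulKg _) _.
by have := commuteD2 x; rewrite /commute expgS expg1.
Qed.

(** * Alternating braids *)

(** The sign [e] is that of the letters [sigma1]; the letters [sigma2] have
    the opposite one. *)
Definition alt_braid (e : bool) (x : braid 3) : Prop :=
  exists w : word 3,
    braid_of_word w = x /\ all (fun y => (y.1 == ord0) == (y.2 == e)) w.

Definition alternating_braid x := exists e, alt_braid e x.

Lemma alt_braid1 e : alt_braid e 1.
Proof. by exists [::]. Qed.

Lemma alt_braidM e x y :
  alt_braid e x -> alt_braid e y -> alt_braid e (x * y).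
Proof.
move=> [u [<- au]] [v [<- av]]; exists (u ++ v).
by rewrite braid_of_word_cat all_cat au av.
Qed.

Lemma alt_braidX e x k : alt_braid e x -> alt_braid e (x ^+ k).
Proof.
move=> ax; elim: k => [|k IHk]; first exact: alt_braid1.
by rewrite expgS; exact: alt_braidM.
Qed.

Lemma alt_braidV e x : alt_braid e x -> alt_braid (~~ e) x^-1.
Proof.
move=> [u [<- au]]; exists (word_inv u); split.
  exact: esym (braid_invE u).
rewrite /word_inv all_rev all_map; apply: sub_all au => -[i s] /=.
by case: s; case: e.
Qed.

Lemma alt_braidJ e x : alt_braid e x -> alt_braid (~~ e) (x ^ D).
Proof.
move=> [u [<- au]]; exists (map letter_swap u); split.
  exact: esym (braid_of_wordJ u).
rewrite all_map; apply: sub_all au => -[i s] /=.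
by case: i => -[|[|//]] ?; case: s; case: e.
Qed.

Lemma alt_braid_sigma1 : alt_braid true a.
Proof. by exists [:: (ord0, true)]. Qed.

Lemma alt_braid_sigma1V : alt_braid false a^-1.
Proof. exact: alt_braidV alt_braid_sigma1. Qed.

Lemma alt_braid_sigma2 : alt_braid false b.
Proof. by rewrite -sigma1J; exact: alt_braidJ alt_braid_sigma1. Qed.

Lemma dehornoy_pos_sigma1 (u v : word 3) :
  (ord0, false) \notin u -> (ord0, false) \notin v ->
  dehornoy_pos (braid_of_word u * a * braid_of_word v).
Proof.
move=> Nu Nv; exists (u ++ [:: (ord0, true)] ++ v).
rewrite 2!braid_of_word_cat mulgA; split=> //; exists ord0; split=> //.
  by rewrite !mem_cat inE eqxx orbT.
by rewrite !mem_cat !negb_or Nu Nv.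
Qed.

Lemma alt_true_notin (w : word 3) :
  all (fun y => (y.1 == ord0) == (y.2 == true)) w -> (ord0, false) \notin w.
Proof. by move=> aw; apply/negP => /(allP aw). Qed.

(** The half twist is [aba].  If the letters [a] in the alternating word are
    positive, then adding those of [Delta] leaves no [a^-1].  Otherwise moving
    the word to the other side of [Delta] exchanges the generators and reduces
    to this case. *)
Lemma alternating_halftwist x :
  alternating_braid x -> dehornoy_pos (D * x) /\ dehornoy_pos (x * D).
Proof.
suff pos y : alt_braid true y -> dehornoy_pos (D * y) /\ dehornoy_pos (y * D).
  move=> [[] ax]; first exact: pos.
  have [pos1 pos2] := pos _ (alt_braidJ ax).
  by split; [rewrite -{1}(conjDD x) -conjgC|rewrite conjgC].
pose ba : word 3 := [:: (ord_max, true); (ord0, true)].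
have DE : D = a * braid_of_word ba.
  by rewrite Delta3E -mulgA (braid_of_word_cat [:: _] [:: _]).
move=> [w [<- /alt_true_notin Nw]]; split.
  have -> : D * braid_of_word w =
      braid_of_word [::] * a * braid_of_word (ba ++ w).
    by rewrite braid_of_word_cat (mul1g a) mulgA -DE.
  by apply: dehornoy_pos_sigma1.
by rewrite DE mulgA; exact: dehornoy_pos_sigma1.
Qed.

(** An alternating word which contains [a] or [a^-1] is sigma-positive or
    sigma-negative; otherwise it is a power of [b]. *)
Lemma alternating_trichotomy x :
  alternating_braid x -> [\/ x = 1, dehornoy_pos x | dehornoy_pos x^-1].
Proof.
suff tri y : alt_braid true y -> [\/ y = 1, dehornoy_pos y | dehornoy_pos y^-1].
  move=> [[] ax]; first exact: tri.
  case: (tri _ (alt_braidV ax)) => [/eqP|px|]; last rewrite invgK => px.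
  - by rewrite invg_eq1 => /eqP x1; constructor 1.
  - by constructor 3.
  by constructor 2.
move=> [w [<- aw]]; have Nw := alt_true_notin aw.
have [w0|Nw0] := boolP ((ord0, true) \in w).
  by constructor 2; exists w; split=> //; exists ord0.
case: w aw Nw Nw0 => [|z w] aw Nw Nw0; first by constructor 1.
constructor 3; exists (word_inv (z :: w)); split.
  exact: esym (braid_invE _).
have all_max t : t \in z :: w -> t = (ord_max, false) :> letter 3.
  case: t => i s yw; have ni : i != ord0.
    apply/negP => /eqP i0; case: s yw; rewrite i0.
      by rewrite (negbTE Nw0).
    by rewrite (negbTE Nw).
  have := allP aw _ yw; rewrite /= (negbTE ni); case: s {yw} => //= _.
  by congr (_, _); apply: val_inj; case: i ni => [[|[|//]] ?].
have inv_max t : t \in word_inv (z :: w) -> t = (ord_max, true) :> letter 3.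
  by rewrite /word_inv mem_rev => /mapP[u /all_max-> ->].
exists ord_max; split.
- rewrite /word_inv mem_rev; apply/mapP; exists z; first exact: mem_head.
  by rewrite (all_max z) ?mem_head.
- by apply/negP => /inv_max.
by move=> j e jmax; apply/negP => /inv_max[jE _]; rewrite jE ltnn in jmax.
Qed.

Lemma alternatingV x : alternating_braid x -> alternating_braid x^-1.
Proof. by case=> e ax; exists (~~ e); exact: alt_braidV. Qed.

(** Adding on the left of an alternating word a letter [x] that breaks
    the alternation either cancels the first letter [y], or gives [x y] equal to
    [Delta] or [Delta^-1] times the letter inverse to [x], which restores it. *)
Lemma twist_alternating x :
  exists m u,
    alternating_braid u /\ (x = twist m * u \/ x = twist m * (D * u)).
Proof.
pose nf y := exists m u,
  alternating_braid u /\ (y = twist m * u \/ y = twist m * (D * u)).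
have nf_alt e y : alt_braid e y -> nf y.
  by move=> ay; exists 0%R, y; split; [exists e|left; rewrite mul1g].
have nf_twist m y : nf y -> nf (twist m * y).
  move=> [n [u [au yE]]]; exists (m + n)%R, u; split=> //.
  by case: yE => ->; [left|right]; rewrite mulgA -twistD.
have nfD y : nf y -> nf (D * y).
  move=> [n [u [au [->|->]]]].
    by exists n, u; split=> //; right; rewrite !mulgA commute_twist.
  exists (1 + n)%R, u; split=> //; left.
  by rewrite twistD twist1 !mulgA -(mulgA D) -commute_twist !mulgA.
have nfDV y : nf y -> nf (D^-1 * y).
  by move=> /nfD/(nf_twist (- 1)%R); rewrite twistN twist1 invgM -!mulgA mulKg.
have nf_gen x0 u : alternating_braid u -> nf (letter_braid x0 * u).
  case=> e [w [<- aw]]; have [ax|Nax] := boolP ((x0.1 == ord0) == (x0.2 == e)).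
    apply: (nf_alt e); exists (x0 :: w).
    by rewrite /= ax -cat1s braid_of_word_cat.
  case: w aw => [_|y w /= /andP[ay aw]].
    rewrite mulg1; apply: (nf_alt (~~ e)); exists [:: x0]; split=> //=.
    by case: (x0.1 == ord0) Nax; case: (x0.2); case: (e).
  have fx : alt_braid e (letter_braid (flip x0) * braid_of_word w).
    exists (flip x0 :: w); rewrite -cat1s braid_of_word_cat /=; split=> //.
    by rewrite aw; case: (x0.1 == ord0) Nax; case: (x0.2); case: (e).
  rewrite -cat1s braid_of_word_cat -/(letter_braid y) mulgA.
  have [y_flip|yN] := eqVneq y (flip x0).
    rewrite y_flip letter_braid_flip mulgV mul1g.
    by apply: (nf_alt e); exists w.
  (* The letters are then distinct generators of the same sign. *)
  suff -> : letter_braid x0 * letter_braid y =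
      (if x0.2 then D else D^-1) * letter_braid (flip x0).
    by rewrite -mulgA; case: x0.2; [apply: nfD|apply: nfDV]; exact: nf_alt fx.
  rewrite letter_braid_flip !letter_braidE.
  have aV : a^-1 * b^-1 = D^-1 * a.
    rewrite -invgM sigma21 invgM invgK; apply: (canLR (mulgK _)).
    by rewrite -mulgA sigma1D mulKg.
  have bV : b^-1 * a^-1 = D^-1 * b.
    rewrite -invgM sigma12 invgM invgK; apply: (canLR (mulgK _)).
    by rewrite -mulgA sigma2D mulKg.
  case: x0 Nax yN {fx} => i s Nax yN; case: y ay yN => j t /= ay yN.
  have eq_ord : (i == ord0) = (j == ord0) -> i = j.
    move=> ij; apply: val_inj.
    by case: i j ij {Nax ay yN} => [[|[|//]] ?] [[|[|//]] ?].
  have ij : (i == ord0) != (j == ord0).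
    apply/negP => /eqP ij; case/negP: yN; rewrite (eq_ord ij); apply/eqP.
    congr (_, _); move: Nax ay; rewrite ij /=.
    by case: (j == ord0); case: (s); case: (t); case: (e).
  move: ij Nax ay; case: (i == ord0); case: (j == ord0); case: (s); case: (t);
  by case: (e) => //= *; rewrite ?invgK ?sigma12 ?sigma21.
have nf_genM x0 y : nf y -> nf (letter_braid x0 * y).
  move=> [m [u [au [->|->]]]]; rewrite mulgA commute_twist -mulgA;
    apply: nf_twist.
    exact: nf_gen.
  by rewrite mulgA (conjgC _ D) letter_braidJ -mulgA; apply/nfD/nf_gen.
have [w ->] := braid_of_word_surj x; elim: w => [|y w IHw].
  by apply: (nf_alt true); exact: alt_braid1.
by rewrite -cat1s braid_of_word_cat; exact: nf_genM.
Qed.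

(** * The floor is a quasimorphism *)

Lemma is_floorE (x : braid 3) m :
  is_floor x m <->
  dehornoy_le (twist m) x /\ dehornoy_lt x (twist (m + 1)%R).
Proof. by rewrite /is_floor mulrDr. Qed.

Lemma twist_le m n : (m <= n)%R -> dehornoy_le (twist m) (twist n).
Proof.
move=> mn; have -> : n = (m + `|n - m|%N)%R by lia.
elim: `|_|%N => [|k IHk]; first by left; rewrite addr0.
apply: dehornoy_le_trans IHk _; right.
have -> : (m + k.+1 = m + k + 1)%R by lia.
rewrite (twistD (m + k)) -{1}(mulg1 (twist (m + k))).
apply/dehornoy_lt_mul2l; rewrite /dehornoy_lt invg1 mul1g twist1.
by have [] := alternating_halftwist (ex_intro _ true (alt_braid1 true));
  rewrite mulg1 => ? ?; exact: dehornoy_pos_mul.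
Qed.

Lemma twist_lt_index x m n :
  dehornoy_le (twist m) x -> dehornoy_lt x (twist n) -> (m < n)%R.
Proof.
move=> mx xn; rewrite ltNge; apply/negP => /twist_le nm.
exact/(@dehornoy_lt_irr x)/(dehornoy_lt_le_trans xn)/(dehornoy_le_trans nm).
Qed.

Lemma is_floor_unique (x : braid 3) m n : is_floor x m -> is_floor x n -> m = n.
Proof.
move=> /is_floorE[mx xm] /is_floorE[nx xn].
by have := twist_lt_index mx xn; have := twist_lt_index nx xm; lia.
Qed.

Lemma is_floor_twist m (x : braid 3) n :
  is_floor x n -> is_floor (twist m * x) (m + n)%R.
Proof.
move=> /is_floorE[nx xn]; apply/is_floorE.
rewrite -addrA (twistD m n) (twistD m).
by split; [exact: dehornoy_le_mul2l|apply/dehornoy_lt_mul2l].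
Qed.

Lemma alternating_floor x :
  alternating_braid x -> is_floor x 0%R \/ is_floor x (- 1)%R.
Proof.
move=> ax; have [posDx posxD] := alternating_halftwist ax.
have [posDV posVD] := alternating_halftwist (alternatingV ax).
have posD : dehornoy_pos D.
  have [+ _] := alternating_halftwist (ex_intro _ true (alt_braid1 true)).
  by rewrite mulg1.
have xT : dehornoy_lt x (twist 1).
  by rewrite /dehornoy_lt twist1 mulgA; exact: dehornoy_pos_mul.
have Tx : dehornoy_lt (twist (- 1)) x.
  by rewrite /dehornoy_lt twistN invgK twist1 -mulgA; exact: dehornoy_pos_mul.
have [x1|px|pxV] := alternating_trichotomy ax.
- by left; apply/is_floorE; split=> //; left.
- by left; apply/is_floorE; split=> //; right; rewrite /dehornoy_lt invg1 mul1g.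
right; apply/is_floorE; split; first by right.
by rewrite addNr /dehornoy_lt mulg1.
Qed.

Lemma halftwist_floor x : alternating_braid x -> is_floor (D * x) 0%R.
Proof.
move=> ax; have [posDx _] := alternating_halftwist ax.
have [_ posVD] := alternating_halftwist (alternatingV ax).
apply/is_floorE; split; first by right; rewrite /dehornoy_lt invg1 mul1g.
by rewrite /dehornoy_lt add0r twist1 invgM !mulgA mulgVK.
Qed.

Lemma floor_exists (x : braid 3) : exists m, is_floor x m.
Proof.
have [m [u [au [->|->]]]] := twist_alternating x.
  by case: (alternating_floor au) => /(is_floor_twist m); eexists; eassumption.
by exists (m + 0)%R; apply/is_floor_twist/halftwist_floor.
Qed.

Lemma dehornoy_floorP (x : braid 3) : is_floor x (dehornoy_floor x).
Proof. by have [m] := floor_exists x; exact: xgetI. Qed.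

Lemma dehornoy_floorE (x : braid 3) m : is_floor x m -> dehornoy_floor x = m.
Proof. exact/is_floor_unique/dehornoy_floorP. Qed.

Lemma dehornoy_floor_twist m x :
  dehornoy_floor (twist m * x) = (m + dehornoy_floor x)%R.
Proof. exact/dehornoy_floorE/is_floor_twist/dehornoy_floorP. Qed.

(** The order is only left-invariant; that [Delta^2] is central replaces
    the invariance on the right. *)
Lemma dehornoy_floorM (x y : braid 3) :
  (dehornoy_floor x + dehornoy_floor y <= dehornoy_floor (x * y)%g
   <= dehornoy_floor x + dehornoy_floor y + 1)%R.
Proof.
have /is_floorE[] := dehornoy_floorP (x * y).
move: (dehornoy_floor (x * y)) => k.
have /is_floorE[] := dehornoy_floorP y; move: (dehornoy_floor y) => m.
have /is_floorE[] := dehornoy_floorP x; move: (dehornoy_floor x) => n.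
move=> nx xn my ym kxy xyk.
have nmxy : dehornoy_le (twist (n + m)%R) (x * y).
  rewrite addrC twistD; apply: dehornoy_le_trans (dehornoy_le_mul2l _ nx) _.
  by rewrite -commute_twist; exact: dehornoy_le_mul2l.
have xynm : dehornoy_lt (x * y) (twist (m + 1 + (n + 1))%R).
  apply: (@dehornoy_lt_trans _ (x * twist (m + 1))).
    exact/dehornoy_lt_mul2l.
  by rewrite commute_twist (twistD (m + 1)); exact/dehornoy_lt_mul2l.
have := twist_lt_index nmxy xyk; have := twist_lt_index kxy xynm; lia.
Qed.

(** * Rate of twisting *)

Lemma twistX m k : (twist m) ^+ k = twist (m * k%:Z)%R.
Proof.
elim: k => [|k IHk]; first by rewrite mulr0.
by rewrite expgSr IHk intS mulrDr mulr1 addrC twistD.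
Qed.

Section Rate.
Variable R : realType.
Implicit Types (x y : braid 3) (c : R).

(** Asking for a bounded error rather than for a limit makes the rate easy to
    transport, since the floor is additive up to a bounded error. *)
Definition twist_rate x c : Prop :=
  exists C : R, forall k : nat,
    (`|(dehornoy_floor (x ^+ k)%g)%:~R - c * k%:R| <= C)%R.

Lemma twist_rate_fdtc x c : twist_rate x c -> is_fdtc x c.
Proof.
move=> [C xC].
have C0 : (0 <= C)%R by exact: le_trans (xC 0).
have cvg_c : (floor_ratio R x @ \oo --> c)%classic.
  apply/cvgrPdist_le => e e0; near=> k.
  have k0 : (0 < k%:R :> R)%R by rewrite ltr0n; near: k; exact: nbhs_infty_gt.
  rewrite distrC /floor_ratio.
  have -> : (c = c * k%:R / k%:R)%R by rewrite mulfK ?gt_eqF.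
  rewrite -mulrBl normrM normfV (gtr0_norm k0) ler_pdivrMr//.
  apply: le_trans (xC k) _; rewrite mulrC -ler_pdivrMr//.
  by near: k; exact: nbhs_infty_ger.
split.
- move=> k; exists (dehornoy_floor (x ^+ k)).
  split; first exact: dehornoy_floorP.
  by move=> m; exact: dehornoy_floorE.
- by apply/cvg_ex; exists c.
exact/cvg_lim.
Unshelve. all: by end_near.
Qed.

Lemma twist_rate_conj x y c : conjugate y x -> twist_rate x c -> twist_rate y c.
Proof.
move=> [g ->] [C xC].
pose p : R := (dehornoy_floor g^-1%g)%:~R%R.
pose q : R := (dehornoy_floor g)%:~R%R.
exists (`|p| + `|q| + 2 + C)%R => k; rewrite -conjXg conjgE; have := xC k.
have := dehornoy_floorM g^-1 (x ^+ k * g); have := dehornoy_floorM (x ^+ k) g.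
rewrite -!(ler_int R) !rmorphD /= -/p -/q.
move: (lexx `|p|%R) (lexx `|q|%R); rewrite !ler_norml; lra.
Qed.

Lemma twist_rate_twist x c m :
  twist_rate x c -> twist_rate (twist m * x) (c + m%:~R)%R.
Proof.
move=> [C xC]; exists C => k.
have -> : (twist m * x) ^+ k = twist (m * k%:Z) * x ^+ k.
  rewrite expgMn; last exact/commute_sym/commute_twist.
  by rewrite twistX.
rewrite dehornoy_floor_twist rmorphD rmorphM /=.
rewrite [X in `|X|%R](_ : _ = (dehornoy_floor (x ^+ k)%g)%:~R - c * k%:R)%R //.
by rewrite -!pmulrn; ring.
Qed.

Lemma twist_rate_alternating x : alternating_braid x -> twist_rate x 0%R.
Proof.
move=> [e ax]; exists 1%R => k; rewrite mul0r subr0 ler_norml.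
have /alternating_floor[] : alternating_braid (x ^+ k).
- by exists e; exact: alt_braidX.
- by move/dehornoy_floorE ->; lra.
by move/dehornoy_floorE ->; rewrite rmorphN /=; lra.
Qed.

(** Writing [k] in base [n], only the finitely many remainders contribute to
    the error. *)
Lemma twist_rate_root x n m :
  (0 < n)%N -> x ^+ n = twist m -> twist_rate x (m%:~R / n%:R)%R.
Proof.
move=> n0 xn.
pose B : R := (\sum_(i < n) `|(dehornoy_floor (x ^+ i)%g)%:~R| )%R.
exists (B + `|m%:~R|)%R => k.
have xk : x ^+ k = twist (m * (k %/ n)%N%:Z) * x ^+ (k %% n).
  by rewrite {1}(divn_eq k n) expgnDr mulnC expgnA xn twistX.
rewrite xk dehornoy_floor_twist rmorphD rmorphM /=.
have kn : (k%:R = (k %/ n)%:R * n%:R + (k %% n)%:R :> R)%R.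
  by rewrite -natrM -natrD -divn_eq.
have n0R : (0 < n%:R :> R)%R by rewrite ltr0n.
rewrite [X in `|X|%R](_ : _ = (dehornoy_floor (x ^+ (k %% n))%g)%:~R
                           - m%:~R * ((k %% n)%:R / n%:R))%R; last first.
  by rewrite kn; field; rewrite gt_eqF.
apply: le_trans (ler_normB _ _) _; apply: lerD.
  rewrite /B (bigD1 (Ordinal (ltn_pmod k n0)))//= lerDl.
  by apply: sumr_ge0.
rewrite normrM ler_piMr// ger0_norm ?divr_ge0//.
by rewrite ler_pdivrMr// mul1r ler_nat ltnW// ltn_pmod.
Qed.

End Rate.

(** * The listed conjugacy classes *)

Lemma twistMM m n (u v : braid 3) :
  (twist m * u) * (twist n * v) = twist (m + n)%R * (u * v).
Proof.
by rewrite twistD -!mulgA; congr (_ * _); rewrite !mulgA commute_twist.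
Qed.

Lemma twistJ m (g : braid 3) : twist m ^ g = twist m.
Proof. by rewrite conjgE -commute_twist mulKg. Qed.

Lemma sigma21X_halftwist p :
  b * a ^+ p.+1 * D = twist 1 * (a^-1 * b ^+ p).
Proof.
rewrite expgS mulgA sigma21 twist1 -!mulgA; congr (_ * _).
by rewrite mulgA conjgC conjMg conjVg conjXg sigma1J sigma2J.
Qed.

Lemma sigma1X_halftwist p :
  (a ^+ p.+2 * D) ^ b^-1 = twist 1 * (a^-1 * b ^+ p).
Proof.
have DV : D * b^-1 = a^-1 * D.
  by apply: (canLR (mulgK _)); rewrite -mulgA -sigma1D mulKg.
rewrite conjgE invgK -(mulgA (a ^+ p.+2)) DV (expgSr a p.+1).
by rewrite -(mulgA (a ^+ p.+1)) mulVKg mulgA sigma21X_halftwist.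
Qed.

Lemma sigma12X_block p q :
  (a ^+ p.+2 * b ^+ q.+2) ^ b^-1 = twist 1 * (a^-1 * b ^+ p * a^-1 * b ^+ q).
Proof.
rewrite conjgE invgK (expgSr b q.+1) (mulgA (a ^+ p.+2)) mulgK.
rewrite (expgSr a p.+1) (expgS b q) -(mulgA (a ^+ p.+1)) (mulgA a b) sigma12.
rewrite -(mulgA D) (mulgA (a ^+ p.+1) D) (mulgA b) (mulgA b (a ^+ p.+1)).
by rewrite sigma21X_halftwist !mulgA.
Qed.

(** One conjugation by [b] turns every block into a full twist times an
    alternating braid of the same kind, so the blocks can be multiplied. *)
Lemma block_prod r (p q : nat -> nat) :
  (forall i, (1 <= i <= r)%N -> (2 <= p i)%N /\ (2 <= q i)%N) ->
  exists u, alt_braid false u /\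
    (\prod_(1 <= i < r.+1) (a ^+ p i * b ^+ q i)) ^ b^-1 = twist r%:Z * u.
Proof.
elim: r => [|r IHr] pq2.
  by exists 1; split; [exact: alt_braid1|rewrite big_geq// conj1g mulg1].
have [i /andP[i1 ir]|u [au eu]] := IHr; first by apply: pq2; rewrite i1 ltnW.
have [p2 q2] := pq2 r.+1 (leqnn _).
have [P pE] : exists P, p r.+1 = P.+2 by exists (p r.+1).-2; lia.
have [Q qE] : exists Q, q r.+1 = Q.+2 by exists (q r.+1).-2; lia.
exists (u * (a^-1 * b ^+ P * a^-1 * b ^+ Q)); split.
  have [aV ab] := (alt_braid_sigma1V, alt_braid_sigma2).
  by do !apply: alt_braidM => //; apply: alt_braidX.
rewrite big_nat_recr// conjMg eu pE qE sigma12X_block twistMM.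
by rewrite intS addrC.
Qed.

(** These three braids are periodic: they are conjugate to [ab], [Delta] and
    [(ab)^2], rotations by 1/3, 1/2 and 2/3 of a turn. *)
Lemma sigma1Xsigma2_root :
  [/\ (a * b) ^+ 3 = twist 1, (a ^+ 2 * b) ^+ 2 = twist 1
    & (a ^+ 3 * b) ^+ 3 = twist 2].
Proof.
have abaE x : a * (b * (a * x)) = D * x by rewrite Delta3E !mulgA.
have babE x : b * (a * (b * x)) = D * x by rewrite Delta3E braid3_rel !mulgA.
have aDE x : a * (D * x) = D * (b * x) by rewrite !mulgA sigma1D.
have bDE x : b * (D * x) = D * (a * x) by rewrite !mulgA sigma2D.
have eqE := (abaE, babE, aDE, bDE).
rewrite (twistD 1 1) !twist1.
(* The trailing factor 1 lets the rules also apply at the end of a word. *)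
split; rewrite !(expgS, expg0) !mulg1 -[LHS]mulg1 -[RHS]mulg1 -!mulgA;
  by rewrite !eqE.
Qed.

Theorem corollary6p1 (R : realType) (gamma : braid 3) :
  let a := sigma1 in
  let b := sigma2 in
  let D := expgz (Delta 3) in
  [/\ forall (l : int) (p : nat),
        conjugate gamma (D (2 * l)%R * a ^+ p) ->
        is_fdtc gamma (l%:~R : R)%R,
      forall (l : int) (p : nat), (1 <= p <= 3)%N ->
        conjugate gamma (D (2 * l)%R * a ^+ p * b) ->
        is_fdtc gamma ((p%:R + 1) / 6%:R + l%:~R : R)%R
    & forall (l : int) (r : nat) (p q : nat -> nat), (1 <= r)%N ->
        ((forall i, (1 <= i <= r)%N -> (2 <= p i)%N /\ (2 <= q i)%N) /\
         conjugate gamma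
           (D (2 * l)%R * \prod_(1 <= i < r.+1) (a ^+ p i * b ^+ q i)))
        \/
        [/\ (2 <= p r)%N,
            (forall i, (1 <= i < r)%N -> (2 <= p i)%N /\ (2 <= q i)%N)
          & conjugate gamma
              (D (2 * l + 1)%R
               * (\prod_(1 <= i < r) (a ^+ p i * b ^+ q i)) * a ^+ p r)] ->
        is_fdtc gamma (r%:R + l%:~R : R)%R].
Proof.
have rate_alt x (g : braid 3) m u : alt_braid false u ->
    x ^ g = twist m * u -> twist_rate x (m%:~R : R)%R.
  move=> au xg; apply: (@twist_rate_conj _ (twist m * u)).
    by exists g^-1; rewrite -xg conjgK.
  rewrite -[m%:~R%R]add0r; apply: twist_rate_twist.
  by apply: twist_rate_alternating; exists false.
split=> [l p cg|l p p13 cg|l r p q r1 cg]; apply: twist_rate_fdtc.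
- apply: twist_rate_conj cg _; rewrite -[l%:~R%R]add0r; apply: twist_rate_twist.
  apply: twist_rate_alternating; exists true.
  exact/alt_braidX/alt_braid_sigma1.
- apply: twist_rate_conj cg _; rewrite -mulgA; apply: twist_rate_twist.
  have [ab1 ab2 ab3] := sigma1Xsigma2_root.
  case: p p13 => [|[|[|[|//]]]]// _.
  + rewrite [(_ / _)%R](_ : _ = 1%:~R / 3%:R :> R)%R; last by field.
    exact: twist_rate_root.
  + rewrite [(_ / _)%R](_ : _ = 1%:~R / 2%:R :> R)%R; last by field.
    exact: twist_rate_root.
  rewrite [(_ / _)%R](_ : _ = 2%:~R / 3%:R :> R)%R; last by field.
  exact: twist_rate_root.
rewrite pmulrn -rmorphD /= addrC.
case: cg => [[pq2 cg]|[p2 pq2 cg]]; apply: twist_rate_conj cg _.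
  have [u [au eu]] := block_prod pq2.
  apply: (rate_alt _ sigma2^-1 _ u) => //.
  by rewrite conjMg twistJ eu mulgA -twistD.
(* Conjugating by [Delta] first moves the odd half twist to the end, next to
   the last power of [a]. *)
case: r r1 p2 pq2 => // r _ p2 pq2.
have [u [au eu]] := block_prod pq2.
have [P pE] : exists P, p r.+1 = P.+2 by exists (p r.+1).-2; lia.
apply: (rate_alt _ (Delta 3 * sigma2^-1) _ (u * (sigma1^-1 * sigma2 ^+ P))).
  by do !apply: alt_braidM => //; [exact: alt_braid_sigma1V|
    apply/alt_braidX/alt_braid_sigma2].
have halfJ y : (Delta 3 * y) ^ (Delta 3) = y * Delta 3.
  by rewrite conjgE -mulgA mulKg.
have D1 : expgz (Delta 3) 1 = Delta 3 by exact: expg1.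
rewrite pE expgzD D1 -(mulgA (twist l)) -(mulgA (twist l)) conjMg twistJ.
rewrite conjgM -(mulgA (Delta 3)) halfJ -mulgA conjMg eu sigma1X_halftwist.
by rewrite twistMM mulgA -twistD intS (addrC 1%R).
Qed.
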